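(* Let $\mathbb{K}$ be an algebraically closed field of characteristic $p>0$. Let $f \in \mathbb{K}[[x]][y]$ be a monic irreducible polynomial of degree $n \geq 1$ (in $y$). The following are equivalent: (1) The polynomial $f$ has a root in the ring $\mathbb{K}[[x^{1/n}]]$. (2) The polynomial $f$ belongs to the ring $\mathbb{K}[[x]][y^{q}]$, where $q := p^{\nu_p(n)}$.
   Context: $\nu_p$ denotes the $p$-adic valuation on $\mathbb{Z}$: for a nonzero integer $n$, $p^{\nu_p(n)}$ is the largest power of $p$ dividing $n$. $\mathbb{K}[[x^{1/n}]]$ is the ring of formal power series in $x^{1/n}$, viewed as an extension of $\mathbb{K}[[x]]$; the elements of $\mathbb{K}[[x^{1/\mathbb{N}}]] := \bigcup_{n\ge 1}\mathbb{K}[[x^{1/n}]]$ are called formal Newton-Puiseux series. *)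

(* Defs.v *)
From HB Require Import structures.
From mathcomp Require Import all_boot all_order all_algebra.
From mathcomp Require Import boolp.

Set Implicit Arguments.
Unset Strict Implicit.
Unset Printing Implicit Defensive.

Import GRing.Theory.
Local Open Scope ring_scope.

Record fps (R : Type) := Fps { fps_coef :> nat -> R }.

(* Equality of power series is not decidable constructively. *)
HB.instance Definition _ (R : Type) := gen_eqMixin (fps R).
HB.instance Definition _ (R : Type) := gen_choiceMixin (fps R).

Lemma fpsP (R : Type) (a b : fps R) : a =1 b -> a = b.
Proof. by case: a b => [a] [b] /= /funext ->. Qed.

Section Zmod.
Variable R : zmodType.
Implicit Types a b c : fps R.

Definition fps_zero : fps R := Fps (fun=> 0).
Definition fps_opp a : fps R := Fps (fun n => - a n).
Definition fps_add a b : fps R := Fps (fun n => a n + b n).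

Fact fps_addA : associative fps_add.
Proof. by move=> a b c; apply: fpsP => n /=; rewrite addrA. Qed.
Fact fps_addC : commutative fps_add.
Proof. by move=> a b; apply: fpsP => n /=; rewrite addrC. Qed.
Fact fps_add0 : left_id fps_zero fps_add.
Proof. by move=> a; apply: fpsP => n /=; rewrite add0r. Qed.
Fact fps_addN : left_inverse fps_zero fps_opp fps_add.
Proof. by move=> a; apply: fpsP => n /=; rewrite addNr. Qed.

HB.instance Definition _ :=
  GRing.isZmodule.Build (fps R) fps_addA fps_addC fps_add0 fps_addN.

Lemma fps0E n : (0 : fps R) n = 0. Proof. by []. Qed.
Lemma fpsDE a b n : (a + b) n = a n + b n. Proof. by []. Qed.
Lemma fpsNE a n : (- a) n = - a n. Proof. by []. Qed.
End Zmod.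

Section Ring.
Variable R : comNzRingType.
Implicit Types a b c : fps R.

Definition fps_one : fps R := Fps (fun n => (n == 0)%:R).
Definition fps_mul a b : fps R :=
  Fps (fun n => \sum_(i < n.+1) a i * b (n - i)%N).

Definition fps_trunc n a : {poly R} := \poly_(i < n.+1) a i.

Lemma coef_fps_trunc n a i : (i <= n)%N -> (fps_trunc n a)`_i = a i.
Proof. by move=> le_in; rewrite coef_poly ltnS le_in. Qed.

Lemma fps_mul_trunc n a b i : (i <= n)%N ->
  fps_mul a b i = (fps_trunc n a * fps_trunc n b)`_i.
Proof.
move=> le_in; rewrite coefM /=; apply: eq_bigr => j _.
have le_ji : (j <= i)%N by rewrite -ltnS.
by rewrite !coef_fps_trunc // ?(leq_trans _ le_in) // leq_subr.
Qed.

Fact fps_mulA : associative fps_mul.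
Proof.
move=> a b c; apply: fpsP => n.
rewrite !(fps_mul_trunc _ _ (leqnn n)).
have E (x y z : {poly R}) : (forall i, (i <= n)%N -> x`_i = y`_i) ->
    (x * z)`_n = (y * z)`_n :> R.
  by move=> xy; rewrite !coefM; apply: eq_bigr => j _; rewrite xy // -ltnS.
rewrite [in RHS](E _ (fps_trunc n a * fps_trunc n b)); last first.
  by move=> i le_in; rewrite coef_fps_trunc // (fps_mul_trunc _ _ le_in).
rewrite [in LHS]mulrC [in LHS](E _ (fps_trunc n b * fps_trunc n c)); last first.
  by move=> i le_in; rewrite coef_fps_trunc // (fps_mul_trunc _ _ le_in).
by rewrite [in LHS]mulrC mulrA.
Qed.

Fact fps_mulC : commutative fps_mul.
Proof.
by move=> a b; apply: fpsP => n; rewrite !(fps_mul_trunc _ _ (leqnn n)) mulrC.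
Qed.

Fact fps_mul1 : left_id fps_one fps_mul.
Proof.
move=> a; apply: fpsP => n /=.
rewrite big_ord_recl /= mul1r subn0 big1 ?addr0 // => i _.
by rewrite /= mul0r.
Qed.

Fact fps_mulDl : left_distributive fps_mul +%R.
Proof.
move=> a b c; apply: fpsP => n /=.
by rewrite -big_split; apply: eq_bigr => i _; rewrite mulrDl.
Qed.

Fact fps_one_neq0 : fps_one != 0.
Proof.
apply/eqP => /(congr1 (fun a : fps R => a 0%N)) /= /eqP.
by rewrite (oner_eq0 R).
Qed.

HB.instance Definition _ := GRing.Zmodule_isComNzRing.Build (fps R)
  fps_mulA fps_mulC fps_mul1 fps_mulDl fps_one_neq0.

Lemma fps1E n : (1 : fps R) n = (n == 0)%:R. Proof. by []. Qed.
Lemma fpsME a b n : (a * b) n = \sum_(i < n.+1) a i * b (n - i)%N.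
Proof. by []. Qed.

Definition fpsX : fps R := Fps (fun n => (n == 1)%:R).

Lemma fpsXnE m n : (fpsX ^+ m) n = (n == m)%:R.
Proof.
elim: m n => [|m IH] n; first by rewrite expr0.
rewrite exprS fpsME; case: n => [|n].
  by rewrite big_ord1 mul0r.
rewrite 2!big_ord_recl /= mul0r add0r mul1r IH subSS subn0 eqSS.
by rewrite big1 ?addr0 // => i _; rewrite mul0r.
Qed.
End Ring.

(* The extension R[[x]] -> R[[x^(1/n)]]: an element of R[[x^(1/n)]] is encoded
   as a series in the variable t = x^(1/n), so that x is sent to t^n. *)
Section Ramify.
Variables (R : comNzRingType) (n : nat).
Implicit Types a b : fps R.

Definition fps_ramify a : fps R :=
  Fps (fun k => if (n %| k)%N then a (k %/ n)%N else 0).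

Fact fps_ramify_zmod_morphism : zmod_morphism fps_ramify.
Proof.
by move=> a b; apply: fpsP => k; rewrite fpsDE fpsNE /=; case: ifP; rewrite ?subr0.
Qed.

Fact fps_ramify_monoid_morphism : monoid_morphism fps_ramify.
Proof.
split=> [|a b]; apply: fpsP => k.
  rewrite !fps1E /=; case: (posnP n) => [->|n_gt0].
    by rewrite dvd0n; case: eqP => [->|].
  case: ifP => [/dvdnP[m ->]|].
    by rewrite mulnK // muln_eq0 (gtn_eqF n_gt0) orbF.
  by case: eqP => // ->; rewrite dvdn0.
rewrite fpsME /=; case: (posnP n) => [->|n_gt0].
  rewrite dvd0n; case: eqP => [->|/eqP k_neq0].
    by rewrite !big_ord1 /=.
  rewrite big1 // => i _; rewrite !dvd0n; case: eqP => [->|]; last by rewrite mul0r.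
  by rewrite subn0 (negPf k_neq0) mulr0.
case: ifP => [/dvdnP[m ->]|ndvd]; last first.
  rewrite big1 // => i _; case: ifP => [dvd_i|]; last by rewrite mul0r.
  by rewrite dvdn_subl ?ndvd ?mulr0 // -ltnS.
rewrite mulnK //.
pose F i := (if (n %| i)%N then a (i %/ n)%N else 0) *
  (if (n %| m * n - i)%N then b ((m * n - i) %/ n)%N else 0).
pose G i := a i * b (m - i)%N.
rewrite -(big_mkord xpredT F) -(big_mkord xpredT G).
elim: {1 2}m => [|l IH].
  by rewrite mul0n !big_nat1 /F /G dvdn0 div0n !subn0 dvdn_mull // mulnK.
rewrite big_nat_recr //= IH mulSn.
rewrite [RHS](big_cat_nat (n := (l * n).+1)) //=; last exact: leq_addl.
congr (_ + _).
rewrite big_nat_recr /=; last first.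
  by rewrite -[X in (X < _)%N]add0n ltn_add2r.
rewrite big_nat big1 ?add0r => [|i /andP[lt_i i_lt]].
  by rewrite /F /G -mulSn -mulnBl !dvdn_mull // !mulnK.
rewrite /F; case: ifP => [/dvdnP[j ij]|]; last by rewrite mul0r.
move: lt_i i_lt; rewrite ij -mulSn !ltn_mul2r n_gt0 /= ltnS => lj jl.
by have := leq_trans lj jl; rewrite ltnn.
Qed.

HB.instance Definition _ := GRing.isZmodMorphism.Build (fps R) (fps R)
  fps_ramify fps_ramify_zmod_morphism.
HB.instance Definition _ := GRing.isMonoidMorphism.Build (fps R) (fps R)
  fps_ramify fps_ramify_monoid_morphism.

Lemma fps_ramify_inj : (0 < n)%N -> injective fps_ramify.
Proof.
move=> n_gt0 a b ab; apply: fpsP => k.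
have /= := congr1 (fun s : fps R => s (k * n)%N) ab.
by rewrite dvdn_mull // mulnK.
Qed.

Lemma fps_ramifyX : (0 < n)%N -> fps_ramify (fpsX R) = fpsX R ^+ n.
Proof.
move=> n_gt0; apply: fpsP => k; rewrite fpsXnE /=.
case: ifP => [/dvdnP[m ->]|ndvd].
  by rewrite mulnK // -{2}[n]mul1n eqn_pmul2r.
by case: eqP => // kn; rewrite kn dvdnn in ndvd.
Qed.
End Ramify.

Section Unit.
Variable R : comUnitRingType.
Implicit Types a b : fps R.

Definition fps_unit : {pred fps R} := fun a => a 0 \is a GRing.unit.

(* The first n coefficients of the inverse of a. *)
Fixpoint fps_inv_seq a n : seq R :=
  if n is m.+1 then
    let s := fps_inv_seq a m in
    rcons s ((a 0)^-1 * ((m == 0)%:R - \sum_(i < m) s`_i * a (m - i)%N))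
  else [::].

Definition fps_inv a : fps R :=
  if fps_unit a then Fps (fun n => (fps_inv_seq a n.+1)`_n) else a.

Lemma size_fps_inv_seq a n : size (fps_inv_seq a n) = n.
Proof. by elim: n => //= n IH; rewrite size_rcons IH. Qed.

Lemma nth_fps_inv_seq a n i : (i < n)%N ->
  (fps_inv_seq a n)`_i = (fps_inv_seq a i.+1)`_i.
Proof.
elim: n => // n IH; rewrite ltnS leq_eqVlt => /predU1P[-> //|lt_in].
by rewrite [LHS]nth_rcons size_fps_inv_seq lt_in IH.
Qed.

Fact fps_mulVx : {in fps_unit, left_inverse 1 fps_inv *%R}.
Proof.
move=> a ua; have {}ua : fps_unit a by [].
have ua0 : a 0 \is a GRing.unit by [].
apply: fpsP => n; rewrite /fps_inv ua fpsME fps1E big_ord_recr /= subnn.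
rewrite nth_rcons size_fps_inv_seq ltnn eqxx.
rewrite [_ * a 0]mulrC mulVKr // addrC.
rewrite [X in _ + X](eq_bigr
  (fun i : 'I_n => (fps_inv_seq a n)`_i * a (n - i)%N)).
  by rewrite subrK.
by move=> i _; rewrite (nth_fps_inv_seq _ (ltn_ord i)).
Qed.

Fact fps_unitPl a b : b * a = 1 -> fps_unit a.
Proof.
move/(congr1 (fun s : fps R => s 0%N)); rewrite fpsME big_ord1 fps1E /= => ba1.
by apply/unitrPr; exists (b 0); rewrite mulrC.
Qed.

Fact fps_inv_out : {in [predC fps_unit], fps_inv =1 id}.
Proof. by move=> a nua; rewrite /fps_inv ifN. Qed.

HB.instance Definition _ := GRing.ComNzRing_hasMulInverse.Build (fps R)
  fps_mulVx fps_unitPl fps_inv_out.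
End Unit.

Section Domain.
Variable R : idomainType.

Fact fps_idomain_axiom : GRing.integral_domain_axiom (fps R).
Proof.
have first (a : fps R) : a != 0 ->
    exists i, a i != 0 /\ forall j, (j < i)%N -> a j = 0.
  move=> a_neq0; have exa : exists i, a i != 0.
    apply: contrapT => /forallNP a0; case/eqP: a_neq0; apply: fpsP => i.
    by apply/eqP/negPn/negP/a0.
  case: (ex_minnP exa) => i ai min_i; exists i; split=> // j lt_ji.
  by apply/eqP/negPn/negP => /min_i; rewrite leqNgt lt_ji.
move=> a b ab0; apply/norP => -[/first[i [ai ltai]] /first[j [bj ltbj]]].
have /eqP := congr1 (fun s : fps R => s (i + j)%N) ab0.
have lt_i : (i < (i + j).+1)%N by rewrite ltnS leq_addr.
rewrite fpsME fps0E (bigD1 (Ordinal lt_i)) //= addKn big1 ?addr0.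
  by rewrite mulf_eq0 (negPf ai) (negPf bj).
move=> k k_neq; have {}k_neq : (k : nat) != i by [].
case: (ltngtP k i) k_neq => // [/ltai ->|lt_ik] _; first by rewrite mul0r.
rewrite ltbj ?mulr0 // ltn_subLR ?ltn_add2r //.
by rewrite -ltnS.
Qed.

HB.instance Definition _ :=
  GRing.ComUnitRing_isIntegral.Build (fps R) fps_idomain_axiom.
End Domain.

(* Irreducibility in an integral domain; polydiv's irreducible_poly instead
   relies on pseudo-division and ignores constant factors. *)
Definition irreducible_element (R : idomainType) (a : R) : Prop :=
  [/\ a != 0, a \isn't a GRing.unit &
      forall b c : R, a = b * c -> b \is a GRing.unit \/ c \is a GRing.unit].

(* Main.v *)
(* Write n = q m with q the p-part of n, and x = t^n.

   (1) => (2): for a root z(t), the power z^q is a series w in s = t^q, since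
   Frobenius is additive.  The product of y - w(zeta^i s) over the m-th roots of
   unity has coefficients in K[[s^m]] = K[[x]]; substituting y^q gives a monic
   polynomial of degree n vanishing at z, which is f because f, being
   irreducible, is a minimal polynomial over K((x)).

   (2) => (1): f = g(y^q) with g irreducible of degree m prime to p, and K is
   perfect, so it suffices to find a root of g in K[[x^(1/m)]].  A monic
   polynomial of degree prime to p has a root in some K[[x^(1/N)]]: kill the
   second coefficient by a Tschirnhaus substitution and rescale by a power of x;
   the residue then has at least two distinct roots, and Hensel's lemma splits
   off a factor of smaller degree prime to p.  Take N minimal.  Then p does not
   divide N, because otherwise the derivation x d/dx kills the coefficients of g
   and hence, by separability, the root; and the N conjugates of the root are
   distinct, so N = m. *)
Require Import Defs.
From HB Require Import structures.
From mathcomp Require Import all_boot all_order all_algebra.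
From mathcomp Require Import all_solvable all_field.
From mathcomp Require Import ring zify.
From mathcomp Require boolp.

Set Implicit Arguments.
Unset Strict Implicit.
Unset Printing Implicit Defensive.

Import GRing.Theory.
Local Open Scope ring_scope.

(** * Coefficients of series, reduction modulo x, and the substitution t -> ct *)

Section Coefficients.
Variable R : comNzRingType.
Implicit Types a b : fps R.

Lemma fps_sumE (I : Type) (r : seq I) (P : pred I) (F : I -> fps R) n :
  (\sum_(i <- r | P i) F i) n = \sum_(i <- r | P i) F i n.
Proof.
by apply: (big_rec2 (fun (x : fps R) y => x n = y)) => // i x y _ <-.
Qed.

Lemma fpsXnME k a n :
  (fpsX R ^+ k * a) n = if (n < k)%N then 0 else a (n - k)%N.
Proof.
rewrite fpsME; case: ltnP => [lt_nk|le_kn].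
  rewrite big1 // => i _; rewrite fpsXnE ltn_eqF ?mul0r //.
  by apply: leq_ltn_trans lt_nk; rewrite -ltnS.
rewrite (bigD1 (Ordinal (n := n.+1) (m := k) le_kn)) //= fpsXnE eqxx mul1r.
rewrite big1 ?addr0 // => i ni.
by rewrite fpsXnE (negPf (ni : (i : nat) != k)) mul0r.
Qed.

Lemma fps_divXn k a : (forall i, (i < k)%N -> a i = 0) ->
  exists b, a = fpsX R ^+ k * b.
Proof.
move=> a0; exists (Fps (fun i => a (i + k)%N)); apply: fpsP => n.
rewrite fpsXnME /=; case: ltnP => [/a0 //|le_kn].
by rewrite subnK.
Qed.

Definition fps_ct a : R := a 0%N.

Fact fps_ct_zmod_morphism : zmod_morphism fps_ct. Proof. by []. Qed.
Fact fps_ct_monoid_morphism : monoid_morphism fps_ct.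
Proof. by split=> // a b; rewrite /fps_ct fpsME big_ord1. Qed.

HB.instance Definition _ := GRing.isZmodMorphism.Build (fps R) R
  fps_ct fps_ct_zmod_morphism.
HB.instance Definition _ := GRing.isMonoidMorphism.Build (fps R) R
  fps_ct fps_ct_monoid_morphism.

Variable c : R.

(** The substitution t -> ct. When [c ^+ n = 1] it fixes the series in t^n, so it serves as a Galois
    conjugation over them. *)
Definition fps_dilate a : fps R := Fps (fun n => c ^+ n * a n).

Fact fps_dilate_zmod_morphism : zmod_morphism fps_dilate.
Proof. by move=> a b; apply: fpsP => n; rewrite /= mulrDr mulrN. Qed.
Fact fps_dilate_monoid_morphism : monoid_morphism fps_dilate.
Proof.
split=> [|a b]; apply: fpsP => n; rewrite /=.
  by case: n => [|n]; rewrite ?mulr1 ?mulr0.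
rewrite mulr_sumr; apply: eq_bigr => i _.
by rewrite mulrACA -exprD subnKC // -ltnS.
Qed.

HB.instance Definition _ := GRing.isZmodMorphism.Build (fps R) (fps R)
  fps_dilate fps_dilate_zmod_morphism.
HB.instance Definition _ := GRing.isMonoidMorphism.Build (fps R) (fps R)
  fps_dilate fps_dilate_monoid_morphism.

Lemma fps_dilate_ramify n a : c ^+ n = 1 ->
  fps_dilate (fps_ramify n a) = fps_ramify n a.
Proof.
move=> cn1; apply: fpsP => k /=; case: ifP => [/dvdnP[m ->]|_].
  by rewrite mulnC exprM cn1 expr1n mul1r.
by rewrite mulr0.
Qed.

End Coefficients.

(** * Series and polynomials in t^n *)

Section RamifyTheory.
Variable R : comNzRingType.
Implicit Types a b : fps R.

Lemma fps_ramify_comp m n a :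
  fps_ramify m (fps_ramify n a) = fps_ramify (m * n) a.
Proof.
apply: fpsP => k /=; case: (posnP m) => [->|m_gt0].
  rewrite mul0n !dvd0n; case: eqP => [->|//]; by rewrite dvdn0 !div0n.
case: ifP => [/dvdnP[j ->]|ndv].
  by rewrite mulnK // [(m * n)%N]mulnC dvdn_pmul2r // divnMr.
case: ifP => // /(dvdn_trans (dvdn_mulr n (dvdnn m))); by rewrite ndv.
Qed.

Lemma fps_ramifyP n a : (0 < n)%N ->
  (forall k, ~~ (n %| k)%N -> a k = 0) -> exists b, a = fps_ramify n b.
Proof.
move=> n_gt0 a0; exists (Fps (fun k => a (k * n)%N)); apply: fpsP => k /=.
by case: ifPn => [dv|/a0 //]; rewrite divnK.
Qed.

Lemma fps_ramify_poly n (g : {poly fps R}) : (0 < n)%N ->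
  (forall i k, ~~ (n %| k)%N -> g`_i k = 0) ->
  exists h, g = map_poly (fps_ramify n) h.
Proof.
move=> n_gt0 g0.
exists (\poly_(i < size g) Fps (fun k => g`_i (k * n)%N)); apply/polyP => i.
rewrite coef_map /= coef_poly; case: ltnP => [lt_i|le_i].
  by apply: fpsP => k /=; case: ifPn => [/divnK->|/g0->].
by rewrite rmorph0 nth_default.
Qed.

Lemma map_poly_fps_ramify_comp m n (g : {poly fps R}) :
  map_poly (fps_ramify m) (map_poly (fps_ramify n) g) =
  map_poly (fps_ramify (m * n)) g.
Proof. by apply/polyP => i; rewrite !coef_map /= fps_ramify_comp. Qed.

Lemma size_map_fps_ramify n (g : {poly fps R}) : (0 < n)%N ->
  size (map_poly (fps_ramify n) g) = size g.
Proof.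
by move=> n_gt0; rewrite size_map_inj_poly ?rmorph0 //; apply: fps_ramify_inj.
Qed.

End RamifyTheory.

(** * Gauss's lemma over K[[x]] and minimality of irreducible polynomials *)

Lemma poly_scalerI (R : idomainType) (c : R) (f g : {poly R}) :
  c != 0 -> c *: f = c *: g -> f = g.
Proof.
by move=> c0; rewrite -!mul_polyC; apply: mulfI; rewrite polyC_eq0.
Qed.

Section Gauss.
Variable K : fieldType.
Implicit Types (a b : fps K) (f g r : {poly fps K}).

Lemma fps_unitE a : (a \is a GRing.unit) = (fps_ct a != 0).
Proof. by rewrite -unitfE. Qed.

Lemma fpsX_neq0 : fpsX K != 0.
Proof.
apply/eqP => /(congr1 (fun a : fps K => a 1%N)) /= /eqP.
by rewrite (oner_eq0 K).
Qed.

Lemma poly_fps_divX r : map_poly (@fps_ct K) r = 0 ->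
  exists r', r = fpsX K *: r'.
Proof.
move=> r0; exists (\poly_(i < size r) Fps (fun k => r`_i k.+1)).
apply/polyP => i; rewrite coefZ coef_poly; case: ltnP => [_|le_i]; last first.
  by rewrite nth_default // mulr0.
apply: fpsP => k; rewrite -[fpsX K]expr1 fpsXnME.
case: k => [|k]; last by rewrite ltnS ltn0 subn1.
by have := congr1 (fun g : {poly K} => g`_i) r0; rewrite coef_map coef0.
Qed.

(** Each division by x lowers by one the index [v] of a chosen nonzero term of the leading
    coefficient, so the divisions stop. *)
Lemma poly_fps_primitive r : r != 0 ->
  exists k r', r = fpsX K ^+ k *: r' /\ map_poly (@fps_ct K) r' != 0.
Proof.
move=> r_neq0; have [v rv] : exists v, lead_coef r v != 0.
  apply: boolp.contrapT => /boolp.forallNP r0; case/eqP: r_neq0.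
  apply/eqP; rewrite -lead_coef_eq0; apply/eqP/fpsP => v.
  by apply/eqP/negPn/negP/r0.
elim/ltn_ind: v r r_neq0 rv => v IH r r_neq0 rv.
have [r0|rn0] := eqVneq (map_poly (@fps_ct K) r) 0; last first.
  by exists 0%N, r; rewrite expr0 scale1r.
have [r' rr'] := poly_fps_divX r0; rewrite rr' in r_neq0 rv.
have r'_neq0 : r' != 0 by apply: contraNneq r_neq0 => ->; rewrite scaler0.
rewrite lead_coefZ -[fpsX K]expr1 fpsXnME in rv.
case: v IH rv => [|v] IH; rewrite /= ?eqxx // subSS subn0 => rv.
have [k [s [r's s0]]] := IH v (ltnSn v) r' r'_neq0 rv.
by exists k.+1, s; rewrite rr' r's scalerA -exprS.
Qed.

Lemma fps_factorX a : a != 0 ->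
  exists k u, a = fpsX K ^+ k * u /\ u \is a GRing.unit.
Proof.
rewrite -(polyC_eq0 a) => /poly_fps_primitive[k [r [ar r0]]].
exists k, r`_0; split.
  by have := congr1 (fun g : {poly fps K} => g`_0) ar; rewrite coefC coefZ.
rewrite fps_unitE -coef_map; apply: contra r0 => /eqP r00.
apply/eqP/polyP => -[|i]; rewrite coef0 // coef_map.
have := congr1 (fun g : {poly fps K} => g`_i.+1) ar; rewrite coefC coefZ /=.
move/esym/eqP; rewrite mulf_eq0 expf_eq0 (negPf fpsX_neq0) andbF /=.
by move/eqP->; rewrite rmorph0.
Qed.

(** Modulo x the product lives in the domain K[y], where [g] stays nonzero; so [r] absorbs the
    factors x one at a time. *)
Lemma fps_gauss k f g r : map_poly (@fps_ct K) g != 0 ->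
  fpsX K ^+ k *: f = r * g -> exists r', r = fpsX K ^+ k *: r'.
Proof.
move=> g0; elim: k f => [|k IH] f frg; first by exists r; rewrite scale1r.
rewrite exprSr -scalerA in frg.
have [r' rr'] := IH _ frg; rewrite {}rr' -scalerAl in frg *.
have Xk_neq0 : fpsX K ^+ k != 0 by rewrite expf_neq0 // fpsX_neq0.
have {}frg := poly_scalerI Xk_neq0 frg.
have : map_poly (@fps_ct K) r' * map_poly (@fps_ct K) g == 0.
  by rewrite -rmorphM -frg /= map_polyZ; apply/eqP/scale0r.
rewrite mulf_eq0 (negPf g0) orbF => /eqP/poly_fps_divX[r'' ->].
by exists r''; rewrite scalerA -exprSr.
Qed.

(* Gauss's lemma: f remains irreducible over K((x)), so it is minimal for z. *)
Lemma irreducible_fps_min (S : idomainType) (phi : {rmorphism fps K -> S})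
    f r (z : S) :
  injective phi -> f \is monic -> irreducible_element f ->
  root (map_poly phi f) z -> root (map_poly phi r) z -> r != 0 ->
  (size f <= size r)%N.
Proof.
move=> phi_inj f_monic [f_neq0 _ f_irr] fz rz r_neq0.
have size_unit g : g \is a GRing.unit -> size g = 1%N.
  by rewrite poly_unitE => /andP[/eqP].
pose d := gcdp f r.
have d_neq0 : d != 0 by rewrite gcdp_eq0 negb_and f_neq0.
have [[c e] /= c_neq0 fed] := Pdiv.WeakIdomain.dvdpP _ _ (dvdp_gcdl f r).
have [k [u [cE u_unit]]] := fps_factorX c_neq0.
(* With the gcd replaced by its primitive part [d'], Gauss's lemma turns a division over K((x)) into
   a factorization over K[[x]]. *)
have [j [d' [dE d'0]]] := poly_fps_primitive d_neq0.
have Xj_neq0 : fpsX K ^+ j != 0 by rewrite expf_neq0 // fpsX_neq0.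
have size_d : size d = size d' by rewrite dE size_scale.
have : fpsX K ^+ k *: (u *: f) = (fpsX K ^+ j *: e) * d'.
  by rewrite scalerA -cE fed -/d dE -scalerAr scalerAl.
move=> /[dup] E /(fps_gauss d'0)[e' eE].
rewrite eE -scalerAl in E.
have Xk_neq0 : fpsX K ^+ k != 0 by rewrite expf_neq0 // fpsX_neq0.
have {}E := poly_scalerI Xk_neq0 E.
(* If the cofactor is a unit, deg f <= deg d' <= deg r. If [d'] is a unit, f and r are coprime over
   K((x)), and a Bezout identity evaluated at z sends a nonzero constant to 0. *)
have /f_irr[] : f = (u^-1 *: e') * d'.
- by rewrite -scalerAl -E scalerA mulVr // scale1r.
- move=> /size_unit size_e; apply: leq_trans (dvdp_leq r_neq0 (dvdp_gcdr f r)).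
  rewrite size_d; suff -> : f = ((u^-1 *: e')`_0) *: d'.
    exact: size_scale_leq.
  by rewrite -mul_polyC -size1_polyC ?size_e // -scalerAl -E scalerA mulVr // scale1r.
move=> /size_unit d'1; have /Bezout_coprimepP[[v w] /= bez] : coprimep f r.
  by rewrite /coprimep size_d d'1.
have /size_poly1P[a a_neq0 aE] : size (v * f + w * r) == 1%N.
  by rewrite (eqp_size bez) size_poly1.
have : phi a == 0.
  have := congr1 (fun g => (map_poly phi g).[z]) aE.
  rewrite rmorphD !rmorphM /= !hornerE (rootP fz) (rootP rz) !mulr0 addr0.
  by rewrite map_polyC hornerC => <-.
by rewrite -(rmorph0 phi) (inj_eq phi_inj) (negPf a_neq0).
Qed.

End Gauss.

(** * Roots of unity and orbit polynomials *)

Section Orbit.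

(** As n is nonzero in [K], X^n - 1 is separable; among its n distinct roots one is primitive. *)
Lemma closed_prim_root (K : closedFieldType) n : n%:R != 0 :> K ->
  exists z : K, n.-primitive_root z.
Proof.
move=> nK; have n_gt0 : (0 < n)%N by case: n nK; rewrite ?eqxx.
have [r Dp] := closed_field_poly_normal ('X^n - 1 : {poly K}).
rewrite (monicP _) ?monicXnsubC // scale1r in Dp.
have rn1 : all n.-unity_root r by apply/allP => z; rewrite -root_prod_XsubC -Dp.
have sz_r : (n < (size r).+1)%N.
  by rewrite -(size_prod_XsubC r id) -Dp size_XnsubC.
have [|z] := hasP (has_prim_root n_gt0 rn1 _ sz_r); last by exists z.
by rewrite -separable_prod_XsubC -Dp separable_Xn_sub_1.
Qed.

(** The product over the conjugates of [w] under t -> [zeta] t is invariant, so its coefficients are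
    series in t^N. *)
Lemma fps_orbit_poly (K : fieldType) N (zeta : K) (w : fps K) :
  N.-primitive_root zeta -> exists g : {poly fps K},
    [/\ g \is monic, size g = N.+1 & root (map_poly (fps_ramify N) g) w].
Proof.
move=> prim; have N_gt0 := prim_order_gt0 prim.
pose P := \prod_(i < N) ('X - (fps_dilate (zeta ^+ i) w)%:P).
have invP : map_poly (fps_dilate zeta) P = P.
  pose F i := 'X - (fps_dilate (zeta ^+ i) w)%:P.
  rewrite rmorph_prod /= (eq_bigr (fun i : 'I_N => F i.+1)) => [|i _]; last first.
    rewrite rmorphB /= map_polyX map_polyC /F; congr (_ - _%:P).
    by apply: fpsP => k /=; rewrite mulrA exprS exprMn.
  (* Dilation shifts the factors by one, and the last wraps around because [zeta ^+ N = 1]. *)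
  rewrite /P; have FN0 : F N = F 0%N by rewrite /F (prim_expr_order prim).
  case: (N) N_gt0 FN0 => // N' _ FN0.
  by rewrite big_ord_recr big_ord_recl /= FN0 mulrC.
have [g PE] : exists g, P = map_poly (fps_ramify N) g.
  apply: fps_ramify_poly => // i k ndv; apply/eqP.
  (* Invariance reads (zeta^k - 1) c = 0 for a coefficient c of t^k. *)
  have := congr1 (fun g : {poly fps K} => g`_i k) invP; rewrite coef_map /= => /eqP.
  rewrite -subr_eq0 -[X in _ - X]mul1r -mulrBl mulf_eq0 subr_eq0.
  by rewrite -(prim_order_dvd prim) (negPf ndv).
have szP : size P = N.+1.
  by rewrite size_prod_XsubC [index_enum _]unlock -enumT size_enum_ord.
have szg : size g = N.+1 by rewrite -szP PE size_map_fps_ramify.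
exists g; split=> //; last first.
  rewrite -PE /P (bigD1 (Ordinal N_gt0)) //= rootM root_XsubC.
  suff -> : fps_dilate (zeta ^+ 0) w = w by rewrite eqxx.
  by apply: fpsP => k /=; rewrite expr0 expr1n mul1r.
apply/monicP/(fps_ramify_inj N_gt0).
have /monicP := monic_prod_XsubC (index_enum 'I_N) xpredT
  (fun i => fps_dilate (zeta ^+ i) w).
rewrite rmorph1 -/P /lead_coef szP PE coef_map /= => <-.
by rewrite szg.
Qed.

End Orbit.

(** * The derivation x d/dx *)

Section Theta.
Variable R : comNzRingType.
Implicit Types (a b w : fps R) (g : {poly fps R}).

(* x d/dx rather than d/dx: no index shift in the Leibniz rule. *)
Definition fps_theta a : fps R := Fps (fun n => a n *+ n).

Lemma fps_thetaD a b : fps_theta (a + b) = fps_theta a + fps_theta b.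
Proof. by apply: fpsP => n /=; rewrite mulrnDl. Qed.

Lemma fps_thetaM a b : fps_theta (a * b) = fps_theta a * b + a * fps_theta b.
Proof.
apply: fpsP => n; rewrite fpsDE !fpsME /= -big_split /= -sumrMnl.
apply: eq_bigr => i _; have le_in : (i <= n)%N by rewrite -ltnS.
by rewrite mulrnAl mulrnAr -mulrnDr subnKC.
Qed.

(** Chain rule: the coefficients are constants for the derivation, so only [w] contributes. *)
Lemma fps_theta_horner g w : (forall i, fps_theta g`_i = 0) ->
  fps_theta g.[w] = g^`().[w] * fps_theta w.
Proof.
elim/poly_ind: g => [|g c IH] g0.
  by rewrite deriv0 !hornerC mul0r; apply: fpsP => n /=; rewrite mul0rn.
rewrite derivMXaddC !hornerE fps_thetaD fps_thetaM IH; last first.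
  by move=> i; have := g0 i.+1; rewrite coefD coefMX coefC /= addr0.
have -> : fps_theta c = 0 by have := g0 0%N; rewrite coefD coefMX coefC /= add0r.
by rewrite addr0 mulrDl addrC mulrAC.
Qed.

Lemma fps_theta_ramify p N a : p \in [pchar R] -> (p %| N)%N ->
  fps_theta (fps_ramify N a) = 0.
Proof.
move=> pR pN; apply: fpsP => k /=; case: ifP => [Nk|_]; last by rewrite mul0rn.
have pk := dvdn_trans pN Nk.
by rewrite -mulr_natr (eqP (etrans (esym (dvdn_pcharf pR k)) pk)) mulr0.
Qed.

End Theta.

Lemma fps_theta_eq0 (R : idomainType) p (a : fps R) : p \in [pchar R] ->
  fps_theta a = 0 -> exists b, a = fps_ramify p b.
Proof.
move=> pR a0; apply: fps_ramifyP; first exact/prime_gt0/(pcharf_prime pR).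
move=> k; rewrite (dvdn_pcharf pR) => kR; apply/eqP.
have /eqP := congr1 (fun a : fps R => a k) a0; rewrite /= -mulr_natr mulf_eq0.
by rewrite (negPf kR) orbF.
Qed.

(** * Frobenius and p-power roots of series *)

Section Frobenius.
Variables (R : comNzRingType) (p : nat).
Hypothesis pR : p \in [pchar R].
Implicit Types a : fps R.

(** Lets the additivity of Frobenius be applied to polynomial truncations. *)
Lemma fps_exp_trunc n a k i : (i <= n)%N -> (a ^+ k) i = (fps_trunc n a ^+ k)`_i.
Proof.
elim: k i => [|k IH] i le_in; first by rewrite !expr0 coef1.
rewrite !exprS fpsME coefM; apply: eq_bigr => j _.
rewrite IH ?(leq_trans (leq_subr _ _)) // coef_fps_trunc //.
by apply: leq_trans le_in; rewrite -ltnS.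
Qed.

Lemma fps_frobenius a : a ^+ p = fps_ramify p (Fps (fun i => a i ^+ p)).
Proof.
have p_gt0 := prime_gt0 (pcharf_prime pR).
apply: fpsP => n; rewrite (fps_exp_trunc a p (leqnn n)) /fps_trunc poly_def.
have pP : p \in [pchar {poly R}] by rewrite pchar_poly.
rewrite -(pFrobenius_autE pP) rmorph_sum /= coef_sum.
under eq_bigr => i _ do
  rewrite pFrobenius_autE exprZn -exprM coefZ coefXn.
case: ifPn => [/dvdnP[m ->]|ndv]; last first.
  rewrite big1 // => i _; case: eqP => [nE|]; last by rewrite mulr0.
  by rewrite nE dvdn_mull in ndv.
have lt_m : (m < (m * p).+1)%N by rewrite ltnS leq_pmulr.
rewrite (bigD1 (Ordinal lt_m)) //= eqxx mulr1 mulnK // big1 ?addr0 // => i ni.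
by rewrite eqn_pmul2r // eq_sym (negPf (ni : (i : nat) != m)) mulr0.
Qed.

Lemma fps_expXp e a : exists b, a ^+ (p ^ e) = fps_ramify (p ^ e) b.
Proof.
elim: e a => [|e IH] a.
  by exists a; rewrite expr1; apply: fpsP => k /=; rewrite dvd1n divn1.
have [b ab] := IH (Fps (fun i => a i ^+ p)).
by exists b; rewrite expnS exprM fps_frobenius -rmorphXn /= ab fps_ramify_comp.
Qed.

End Frobenius.

(** [K] is perfect: each of the e steps takes p-th roots of all coefficients. *)
Lemma fps_ramify_rootXp (K : closedFieldType) p e (w : fps K) :
  p \in [pchar K] -> exists z, z ^+ (p ^ e) = fps_ramify (p ^ e) w.
Proof.
move=> pK; elim: e w => [|e IH] w.
  by exists w; rewrite expr1; apply: fpsP => k /=; rewrite dvd1n divn1.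
have [z zw] := IH w.
have p_gt0 := prime_gt0 (pcharf_prime pK).
have /boolp.choice[r rP] (c : K) : exists d : K, d ^+ p = c.
  have /closed_rootP[d] : size ('X^p - c%:P) != 1%N.
    by rewrite size_XnsubC // eqSS -lt0n.
  by rewrite rootE !hornerE subr_eq0 => /eqP; exists d.
exists (Fps (fun i => r (z i))).
rewrite expnS exprM (fps_frobenius pK) -rmorphXn /= -fps_ramify_comp -zw.
by congr (fps_ramify _ (_ ^+ _)); apply: fpsP => i /=.
Qed.

(** * Hensel's lemma for coprime monic factors *)

Section Hensel.

(** The list [s n] holds the first n values; the default past its end has no influence, since [F n]
    depends only on indices below n. *)
Lemma strong_recursion (T : Type) (x0 : T) (F : nat -> (nat -> T) -> T) :
  (forall n h h', (forall i, (i < n)%N -> h i = h' i) -> F n h = F n h') ->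
  exists h, forall n, h n = F n h.
Proof.
move=> F_ext.
pose s := fix s n := if n is m.+1 then rcons (s m) (F m (nth x0 (s m))) else [::].
have size_s n : size (s n) = n by elim: n => //= n IH; rewrite size_rcons IH.
exists (fun n => F n (nth x0 (s n))) => n; apply: F_ext.
elim: n => // n IH i; rewrite ltnS leq_eqVlt /= nth_rcons size_s.
by case/predU1P => [->|lt_in]; [rewrite ltnn eqxx | rewrite lt_in IH].
Qed.

Variable K : fieldType.
Implicit Types (A B C : {poly K}) (g : {poly fps K}).

(** Solves the linear equation of one lifting step. Bezout gives a solution; once its first part is
    reduced modulo [A], the bound deg C < deg A + deg B keeps the second below deg B. *)
Lemma bezout_split A B : A \is monic -> B \is monic -> coprimep A B ->
  exists ab : {poly K} -> {poly K} * {poly K}, forall C,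
    (size C <= (size A + size B).-2)%N ->
    [/\ (size (ab C).1 < size A)%N, (size (ab C).2 < size B)%N
      & A * (ab C).2 + (ab C).1 * B = C].
Proof.
move=> Am Bm /Bezout_eq1_coprimepP[[u v] /= uv].
have A0 := monic_neq0 Am; have B0 := monic_neq0 Bm.
exists (fun C => ((v * C) %% A, (C - ((v * C) %% A) * B) %/ A)) => C szC /=.
set a := (v * C) %% A; set b := _ %/ A.
have sza : (size a < size A)%N by rewrite ltn_modp.
have bE : A * b = C - a * B.
  rewrite mulrC divpK //; apply/dvdpP; exists (u * C + ((v * C) %/ A) * B).
  have -> : a = v * C - (v * C) %/ A * A by rewrite {1}(divp_eq (v * C) A) addrC addKr.
  by rewrite -{1}[C]mul1r -uv; ring.
split=> //; last by rewrite bE subrK.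
have [->|b0] := eqVneq b 0; first by rewrite size_poly0 size_poly_gt0.
have szAb : (size (A * b)%R <= (size A + size B).-2)%N.
  rewrite bE (leq_trans (size_polyD _ _)) // geq_max szC size_polyN.
  rewrite (leq_trans (size_polyMleq _ _)) //.
  by move: sza; case: (size A) => // k; rewrite ltnS addSn /= => ?;
    rewrite -!subn1 leq_sub2r // leq_add2r.
move: szAb; rewrite mulrC size_Mmonic // => szAb.
move: A0 B0 b0; rewrite -!size_poly_gt0; move: szAb.
set sA := size A; set sB := size B; set sb := size b; lia.
Qed.

Let slice (k : nat) g : {poly K} := \poly_(i < size g) g`_i k.

Let coef_slice k g i : (slice k g)`_i = g`_i k.
Proof. by rewrite coef_poly; case: ltnP => // le_i; rewrite nth_default. Qed.

(* Hensel lifting, one x-adic digit of the two factors at a time. *)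
Lemma fps_hensel g A B : g \is monic -> A \is monic -> B \is monic ->
  coprimep A B -> map_poly (@fps_ct K) g = A * B ->
  exists a b, [/\ g = a * b, a \is monic & b \is monic] /\
    size a = size A /\ size b = size B.
Proof.
move=> gm Am Bm cop gAB; have [ab abP] := bezout_split Am Bm cop.
have A0 := monic_neq0 Am; have B0 := monic_neq0 Bm.
have szg : size g = (size A + size B).-1.
  rewrite -(size_Mmonic A0 Bm) -gAB size_map_poly_id0 // (monicP gm).
  by rewrite rmorph1 oner_eq0.
(* What remains of the x^n digit of [g] after the products of lower digits; the new digits must
   supply exactly this. *)
pose res n (h : nat -> {poly K} * {poly K}) :=
  slice n g - \sum_(i < n | (0 < i)%N) (h i).1 * (h (n - i)%N).2.
pose F n h := if n == 0%N then (A, B) else ab (res n h).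
have F_ext n h h' : (forall i, (i < n)%N -> h i = h' i) -> F n h = F n h'.
  move=> hh; rewrite /F /res; case: eqP => // _; congr (ab (_ - _)).
  apply: eq_bigr => i i_gt0; rewrite hh // hh //.
  by have := ltn_ord i; lia.
have [h hE] := strong_recursion (0, 0) F_ext.
have h0 : h 0%N = (A, B) by rewrite hE.
(* As [g] is monic, its digits after digit 0 lie below its degree; so do the products of correction
   digits. *)
have szres n : (0 < n)%N -> (forall i, (0 < i < n)%N ->
    (size (h i).1 < size A)%N /\ (size (h i).2 < size B)%N) ->
    (size (res n h) <= (size A + size B).-2)%N.
  move=> n_gt0 hn; rewrite (leq_trans (size_polyD _ _)) // geq_max size_polyN.
  apply/andP; split.
    apply/leq_sizeP => j; rewrite coef_slice leq_eqVlt => /predU1P[<-|lt_j].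
      have := monicP gm; rewrite /lead_coef szg => ->.
      by rewrite fps1E gtn_eqF.
    rewrite nth_default // szg; apply: leq_trans lt_j; lia.
  apply: (leq_trans (size_sum _ _ _)); apply/bigmax_leqP => i i_gt0.
  have lt_in := ltn_ord i.
  have [s1 _] : (size (h i).1 < size A)%N /\ (size (h i).2 < size B)%N.
    by apply: hn; lia.
  have [_ s2] : (size (h (n - i)%N).1 < size A)%N /\
      (size (h (n - i)%N).2 < size B)%N by apply: hn; lia.
  apply: leq_trans (size_polyMleq _ _) _.
  have aux x y u v : (x < u -> y < v -> (x + y).-1 <= (u + v).-2)%N by lia.
  exact: aux.
have hP n : (0 < n)%N -> [/\ (size (h n).1 < size A)%N, (size (h n).2 < size B)%N
      & A * (h n).2 + (h n).1 * B = res n h].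
  elim/ltn_ind: n => n IH n_gt0; rewrite {1 2 3 4}hE /F gtn_eqF //.
  apply/abP/szres => // i /andP[i_gt0 lt_in].
  by have [] := IH i lt_in i_gt0.
have szh n : (size (h n).1 <= size A)%N /\ (size (h n).2 <= size B)%N.
  case: n => [|n]; first by rewrite h0.
  by have [s1 s2 _] := hP n.+1 isT; split; apply: ltnW.
pose a := \poly_(i < size A) Fps (fun k => (h k).1`_i).
pose b := \poly_(i < size B) Fps (fun k => (h k).2`_i).
have aE i k : a`_i k = (h k).1`_i.
  rewrite coef_poly; case: ltnP => // le_i; rewrite nth_default //.
  by apply: leq_trans le_i; case: (szh k).
have bE i k : b`_i k = (h k).2`_i.
  rewrite coef_poly; case: ltnP => // le_i; rewrite nth_default //.
  by apply: leq_trans le_i; case: (szh k).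
(* Only digit 0 reaches the top degree, where it is the leading coefficient 1 of [A]. *)
have la : a`_(size A).-1 = 1.
  apply: fpsP => k; rewrite aE fps1E; case: k => [|k].
    by rewrite h0 /=; apply/monicP.
  rewrite nth_default //; have [lt_s _ _] := hP k.+1 isT.
  by rewrite -ltnS prednK // (leq_ltn_trans _ lt_s).
have lb : b`_(size B).-1 = 1.
  apply: fpsP => k; rewrite bE fps1E; case: k => [|k].
    by rewrite h0 /=; apply/monicP.
  rewrite nth_default //; have [_ lt_s _] := hP k.+1 isT.
  by rewrite -ltnS prednK // (leq_ltn_trans _ lt_s).
have sza : size a = size A.
  apply/eqP; rewrite eqn_leq size_poly /= -[size A]prednK ?size_poly_gt0 //.
  by rewrite ltnNge; apply/negP => /leq_sizeP/(_ _ (leqnn _))/eqP; rewrite la oner_eq0.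
have szb : size b = size B.
  apply/eqP; rewrite eqn_leq size_poly /= -[size B]prednK ?size_poly_gt0 //.
  by rewrite ltnNge; apply/negP => /leq_sizeP/(_ _ (leqnn _))/eqP; rewrite lb oner_eq0.
exists a, b; split=> //; split; last 2 first.
- by apply/monicP; rewrite /lead_coef sza.
- by apply/monicP; rewrite /lead_coef szb.
apply/polyP => i; apply: fpsP => k.
rewrite coefM fps_sumE.
transitivity ((\sum_(l < k.+1) (h l).1 * (h (k - l)%N).2)`_i).
  rewrite -coef_slice.
  suff -> : slice k g = \sum_(l < k.+1) (h l).1 * (h (k - l)%N).2 by [].
  case: k => [|k].
    rewrite big_ord1 subnn h0 /= -gAB; apply/polyP => j.
    by rewrite [LHS]coef_slice coef_map.
  have [_ _] := hP k.+1 isT; rewrite /res => /eqP; rewrite eq_sym subr_eq => /eqP ->.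
  (* The first and last terms of the convolution are the two solved for; the middle ones are those
     subtracted in [res]. *)
  rewrite [RHS]big_ord_recl [in RHS]big_ord_recr /= subn0 subnn h0 /=.
  rewrite -addrA; congr (_ + _); rewrite addrC; congr (_ + _).
  by rewrite big_mkcond big_ord_recl /= add0r.
rewrite coef_sum; under eq_bigr => l _ do rewrite coefM.
rewrite exchange_big /=; apply: eq_bigr => j _.
by apply: eq_bigr => l _; rewrite aE bE.
Qed.

End Hensel.

(** * Newton-Puiseux roots in degree prime to p *)

Section NewtonPuiseux.

Lemma size_XaddC_exp (R : nzRingType) (b : R) k :
  size (('X + b%:P) ^+ k) = k.+1.
Proof. by rewrite -[b]opprK polyCN size_exp_XsubC. Qed.

Lemma lead_XaddC_exp (R : nzRingType) (b : R) k : (('X + b%:P) ^+ k)`_k = 1.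
Proof.
rewrite -[b]opprK polyCN; have /monicP := monic_exp k (monicXsubC (- b)).
by rewrite /lead_coef size_exp_XsubC.
Qed.

Lemma coef_XaddC_exp (R : comNzRingType) (b : R) k :
  (('X + b%:P) ^+ k.+1)`_k = b *+ k.+1.
Proof.
elim: k => [|k IH]; first by rewrite expr1 coefD coefX coefC add0r.
rewrite exprSr mulrDr coefD coefMX coefMC /= IH.
by rewrite lead_XaddC_exp mul1r -mulrSr.
Qed.

(** The shift turns the coefficient of y^m into g_m + (m+1) b, and b is chosen to cancel it. *)
Lemma tschirnhaus (R : idomainType) m (g : {poly R}) :
  g \is monic -> size g = m.+2 -> (m.+1%:R : R) \is a GRing.unit ->
  exists b, [/\ g \Po ('X + b%:P) \is monic, size (g \Po ('X + b%:P)) = m.+2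
    & (g \Po ('X + b%:P))`_m = 0].
Proof.
move=> gm szg uR; pose b := - g`_m / m.+1%:R; exists b.
have szX : size ('X + b%:P) = 2%N by rewrite size_XaddC.
split; [|by rewrite size_comp_poly2|].
  rewrite monicE lead_coef_comp ?szX // (monicP gm) mul1r.
  by rewrite lead_coefXaddC expr1n.
rewrite comp_polyE szg !big_ord_recr /= !coefD !coefZ coef_XaddC_exp.
rewrite coef_sum big1 => [|i _]; last first.
  rewrite coefZ [X in _ * X]nth_default ?mulr0 // size_XaddC_exp.
  exact: ltn_ord.
have := monicP gm; rewrite /lead_coef szg /= => ->.
by rewrite lead_XaddC_exp add0r mulr1 mul1r -mulr_natr divrK // subrr.
Qed.

Lemma coprime_split (K : closedFieldType) p m (E : {poly K}) :
  p \in [pchar K] -> E \is monic -> size E = m.+2 -> ~~ (p %| m.+1)%N ->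
  E`_m = 0 -> E != 'X^(m.+1) ->
  exists A B, [/\ A \is monic, B \is monic, coprimep A B & E = A * B] /\
    ~~ (p %| (size A).-1)%N /\ (size A < m.+2)%N.
Proof.
move=> pK Em szE pm Em0 EX; have E0 := monic_neq0 Em.
have /closed_rootP[l El] : size E != 1%N by rewrite szE.
have [k [q]] := multiplicity_XsubC E l; rewrite E0 /= => ql EE.
have Lm : ('X - l%:P) ^+ k \is monic := monic_exp k (monicXsubC l).
have qm : q \is monic by move: Em; rewrite EE monicMr.
have szqk : (size q + k = m.+2)%N.
  by rewrite -szE EE size_Mmonic ?monic_neq0 // size_exp_XsubC addnS.
have k_gt0 : (0 < k)%N.
  by case: k EE {Lm szqk} => // EE; move: El; rewrite EE mulr1 (negPf ql).
have cop : coprimep (('X - l%:P) ^+ k) q.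
  by rewrite coprimep_expl // coprimep_sym coprimep_XsubC.
have szq_gt1 : (1 < size q)%N.
  rewrite ltnNge; apply/negP => szq1.
  have szq : size q = 1%N by apply/eqP; rewrite eqn_leq szq1 size_poly_gt0 monic_neq0.
  have kE : k = m.+1 by move: szqk; rewrite szq add1n => -[].
  have q1 : q = 1.
    have := monicP qm; rewrite /lead_coef szq /= => q0.
    by rewrite (size1_polyC szq1) q0.
  move: Em0 EX; rewrite EE q1 mul1r kE -polyCN coef_XaddC_exp -mulr_natr.
  move/eqP; rewrite mulf_eq0 -(dvdn_pcharf pK) (negPf pm) orbF oppr_eq0.
  by move/eqP->; rewrite oppr0 polyC0 addr0 eqxx.
have [pk|pk] := boolP (p %| k)%N; last first.
  exists (('X - l%:P) ^+ k), q; rewrite size_exp_XsubC /=.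
  by split; [split=> //; rewrite mulrC|split=> //; lia].
exists q, (('X - l%:P) ^+ k); split; first by rewrite coprimep_sym.
split; last by rewrite -szqk -[X in (X < _)%N]addn0 ltn_add2l.
apply: contra pm => pq; have -> : m.+1 = ((size q).-1 + k)%N.
  by apply: succn_inj; rewrite -addSn prednK // ltnW.
exact: dvdn_add.
Qed.

Variable K : fieldType.
Implicit Types g : {poly fps K}.

(* Substituting y = x^(h/L) y with h maximal makes the slope of the first edge
   of the Newton polygon zero: the residue is not a power of y. *)
Lemma newton_rescale m g : g \is monic -> size g = m.+1 -> g != 'X^m ->
  exists L h E, [/\ (0 < L)%N, E \is monic, size E = m.+1,
    map_poly (@fps_ct K) E != 'X^m
    & forall i, (map_poly (fps_ramify L) g)`_i * fpsX K ^+ (h * i) =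
                fpsX K ^+ (h * m) * E`_i].
Proof.
move=> gm szg gX; pose L := m`!; have L_gt0 : (0 < L)%N := fact_gt0 m.
pose G := map_poly (fps_ramify L) g.
have szG : size G = m.+1 by rewrite size_map_fps_ramify.
have Gm : G \is monic by apply: monic_map.
have [j [lt_jm [v Gv]]] : exists j, (j < m)%N /\ exists v, G`_j v != 0.
  apply: boolp.contrapT => /boolp.forallNP G0; case/negP: gX; apply/eqP.
  apply/polyP => i; rewrite coefXn; case: (ltngtP i m) => [lt_im|lt_mi|->].
  - apply: (fps_ramify_inj L_gt0); apply: fpsP => v; rewrite rmorph0.
    case: (iffLR (boolp.not_andP _ _) (G0 i)) => // /boolp.forallNP/(_ v)/negP/negPn/eqP.
    by rewrite coef_map.
  - by rewrite nth_default // szg.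
  - by have := monicP gm; rewrite /lead_coef szg.
(* The Newton polygon lies on or above the line k = h (m - i); the nonzero coefficient found above
   bounds h. *)
pose P h := boolp.asbool (forall i k, (i < m)%N -> (k < h * (m - i))%N -> G`_i k = 0).
have exP : exists h, P h by exists 0%N; apply/boolp.asboolP.
have ubP h : P h -> (h <= v)%N.
  move/boolp.asboolP => Ph; rewrite leqNgt; apply: contra Gv => lt_vh.
  apply/eqP/Ph => //; apply: (leq_trans lt_vh); rewrite leq_pmulr //.
  by rewrite subn_gt0.
case: (ex_maxnP exP ubP) => h /boolp.asboolP Ph max_h.
have /boolp.choice[e eE] (i : nat) : exists e : fps K,
    (i < m)%N -> G`_i = fpsX K ^+ (h * (m - i)) * e.
  have [lt_im|_] := ltnP i m; last by exists 0.
  by have [e] := fps_divXn (Ph i ^~ lt_im); exists e.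
pose E := \poly_(i < m.+1) (if i == m then 1 else e i).
have Em1 : E`_m = 1 by rewrite coef_poly ltnSn eqxx.
have Ei i : (i < m)%N -> E`_i = e i.
  by move=> lt_im; rewrite coef_poly ltnS ltnW // ltn_eqF.
have szE : size E = m.+1.
  by apply: size_poly_eq; rewrite eqxx oner_eq0.
exists L, h, E; split=> //.
- by apply/monicP; rewrite /lead_coef szE.
- suff [i [lt_im Ei0]] : exists i, (i < m)%N /\ e i 0%N != 0.
    apply: contra Ei0 => /eqP/(congr1 (fun g : {poly K} => g`_i)).
    by rewrite coef_map coefXn Ei // (ltn_eqF lt_im) => /eqP.
  apply: boolp.contrapT => /boolp.forallNP e0.
  (* If every [e i] had zero constant term, the slope h could be increased. *)
  suff /max_h : P h.+1 by rewrite ltnn.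
  apply/boolp.asboolP => i k lt_im lt_k.
  have ei0 : e i 0%N = 0.
    by case: (iffLR (boolp.not_andP _ _) (e0 i)) => // /negP/negPn/eqP.
  (* G`_i only involves powers of x^L, and m - i divides L. *)
  have [dvk|ndvk] := boolP (m - i %| k)%N; last first.
    rewrite coef_map /=; case: ifP => // Lk; case/negP: ndvk.
    by apply: dvdn_trans Lk; apply: dvdn_fact; rewrite subn_gt0 lt_im leq_subr.
  case/dvdnP: dvk lt_k => t ->; rewrite ltn_pmul2r ?subn_gt0 // ltnS => le_th.
  rewrite eE // fpsXnME; case: ltnP => // le_ht.
  rewrite leq_pmul2r ?subn_gt0 // in le_ht.
  by have -> : t = h; [apply/eqP; rewrite eqn_leq le_th|rewrite subnn].
- move=> i; have [lt_im|lt_mi|->] := ltngtP i m.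
  + rewrite -/G eE // Ei // mulrAC -exprD -mulnDr subnK 1?ltnW //.
  + by rewrite !nth_default ?mul0r ?mulr0 // ?szE // -/G szG.
  + rewrite Em1 mulr1; have := monicP Gm; rewrite /lead_coef szG /= => ->.
    by rewrite mul1r.
Qed.

End NewtonPuiseux.

Lemma newton_puiseux_tame (K : closedFieldType) p m (g : {poly fps K}) :
  p \in [pchar K] -> g \is monic -> size g = m.+1 -> ~~ (p %| m)%N ->
  exists N z, (0 < N)%N /\ root (map_poly (fps_ramify N) g) z.
Proof.
move=> pK; elim/ltn_ind: m g => -[|m] IH g gm szg pm; first by rewrite dvdn0 in pm.
have uR : (m.+1%:R : fps K) \is a GRing.unit.
  by rewrite fps_unitE rmorph_nat -(dvdn_pcharf pK).
have [b [g'm szg' g'0]] := tschirnhaus gm szg uR.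
set g' := g \Po _ in g'm szg' g'0.
suff [N [z [N_gt0 rz]]] : exists N z, (0 < N)%N /\ root (map_poly (fps_ramify N) g') z.
  exists N, (z + fps_ramify N b); split=> //; move: rz; rewrite !rootE.
  by rewrite map_comp_poly horner_comp rmorphD /= map_polyX map_polyC !hornerE.
have [g'X|g'X] := eqVneq g' 'X^(m.+1).
  by exists 1%N, 0; rewrite g'X map_polyXn rootE hornerXn expr0n.
have [L [h [E [L_gt0 Em szE EX EE]]]] := newton_rescale g'm szg' g'X.
have Ebm : map_poly (@fps_ct K) E \is monic by apply: monic_map.
have szEb : size (map_poly (@fps_ct K) E) = m.+2.
  by rewrite size_map_poly_id0 // (monicP Em) rmorph1 oner_eq0.
have Eb0 : (map_poly (@fps_ct K) E)`_m = 0.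
  have := EE m; rewrite coef_map /= g'0 rmorph0 mul0r => /esym/eqP.
  rewrite mulf_eq0 expf_eq0 (negPf (fpsX_neq0 K)) andbF /= => /eqP Em0.
  by rewrite coef_map /= Em0 rmorph0.
(* The residue factor of degree prime to p lifts to a factor of [E] of smaller degree, to which the
   induction applies. *)
have [A [B [[Am Bm cop EAB] [pA ltA]]]] := coprime_split pK Ebm szEb pm Eb0 EX.
have [a [b' [[Eab am _] [sza _]]]] := fps_hensel Em Am Bm cop EAB.
have A_gt0 : (0 < size A)%N by rewrite size_poly_gt0 monic_neq0.
have [||//|N [z [N_gt0 az]]] := IH (size A).-1 _ a am; [lia | by rewrite sza prednK|].
have Ez : root (map_poly (fps_ramify N) E) z by rewrite Eab rmorphM rootM az.
(* Undoes the rescaling: a root z of [E] gives the root t^h z of g', with t itself ramified by N. *)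
exists (N * L)%N, (fps_ramify N (fpsX K ^+ h) * z); split.
  by rewrite muln_gt0 N_gt0.
rewrite -map_poly_fps_ramify_comp; set G := map_poly (fps_ramify L) g'.
have GE : (map_poly (fps_ramify N) G).[fps_ramify N (fpsX K ^+ h) * z] =
    fps_ramify N (fpsX K ^+ (h * m.+1)) * (map_poly (fps_ramify N) E).[z].
  rewrite !horner_coef !size_map_fps_ramify // szg' szE mulr_sumr.
  apply: eq_bigr => i _; rewrite [in LHS]coef_map [in RHS]coef_map /= exprMn.
  rewrite -rmorphXn /= -exprM !mulrA.
  by rewrite -!rmorphM /= EE.
by rewrite rootE GE (rootP Ez) mulr0.
Qed.

(** * Minimal polynomials and the substitution y -> y^q *)

Lemma irreducible_fps_minpoly (K : fieldType) (S : idomainType)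
    (phi : {rmorphism fps K -> S}) (f g : {poly fps K}) (z : S) :
  injective phi -> f \is monic -> irreducible_element f -> g \is monic ->
  size g = size f -> root (map_poly phi f) z -> root (map_poly phi g) z -> f = g.
Proof.
move=> phi_inj fm f_irr gm szg fz gz; have [n szf] : exists n, size f = n.+1.
  by exists (size f).-1; rewrite prednK // size_poly_gt0 monic_neq0.
apply/eqP; rewrite -subr_eq0; apply/negPn/negP => fg0.
suff : (size f <= n)%N by rewrite szf ltnn.
(* The leading terms cancel, so f - g would be a nonzero polynomial of smaller degree vanishing at
   z. *)
apply: (@leq_trans (size (f - g))).
  apply: (irreducible_fps_min phi_inj fm f_irr fz) => //.
  by rewrite rmorphB rootE hornerD hornerN (rootP fz) (rootP gz) subrr.
apply/leq_sizeP => j; rewrite coefB leq_eqVlt => /predU1P[<-|lt_nj].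
  have := monicP fm; have := monicP gm; rewrite /lead_coef szg szf /= => -> ->.
  by rewrite subrr.
by rewrite !nth_default ?subr0 ?szg ?szf.
Qed.

Lemma comp_Xn_unit (R : idomainType) q (f : {poly R}) : (0 < q)%N ->
  (f \Po 'X^q : {poly R}) \is a GRing.unit -> f \is a GRing.unit.
Proof.
move=> q_gt0; rewrite poly_unitE => /andP[/eqP szf].
have := size_comp_poly f 'X^q; rewrite szf size_polyXn /= => /esym/eqP.
rewrite muln_eq0 (gtn_eqF q_gt0) orbF => /eqP szf0.
have szf1 : (size f <= 1)%N by case: (size f) szf0 => [|[]].
rewrite (size1_polyC szf1) comp_polyC poly_unitE !coefC /= => uf.
rewrite uf size_polyC andbT.
by have -> : f`_0 != 0 by apply: contraTneq uf => ->; rewrite unitr0.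
Qed.

(** A factorization of [f] yields one of f(y^q), and a polynomial that becomes a unit there is one
    already. *)
Lemma irreducible_comp_Xn (R : idomainType) q (f : {poly R}) : (0 < q)%N ->
  (1 < size f)%N -> irreducible_element (f \Po 'X^q) -> irreducible_element f.
Proof.
move=> q_gt0 szf [_ _ f_irr]; split.
- by rewrite -size_poly_gt0 ltnW.
- by rewrite poly_unitE (gtn_eqF szf).
move=> b c fbc; have := f_irr (b \Po 'X^q) (c \Po 'X^q).
rewrite -comp_polyM -fbc => /(_ erefl)[]/(comp_Xn_unit q_gt0); by [left|right].
Qed.

Lemma root_fps_ramify (R : idomainType) d N (g : {poly fps R}) z : (0 < d)%N ->
  root (map_poly (fps_ramify (d * N)) g) (fps_ramify d z) =
  root (map_poly (fps_ramify N) g) z.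
Proof.
move=> d_gt0; rewrite -map_poly_fps_ramify_comp !rootE horner_map /=.
by rewrite raddf_eq0 //; apply: fps_ramify_inj.
Qed.

(** With s = t^q, [w] is a series in s, and x = t^(qm) = s^m. *)
Lemma root_ramify_comp_Xn (R : idomainType) q m (g : {poly fps R}) z w :
  (0 < q)%N -> z ^+ q = fps_ramify q w ->
  root (map_poly (fps_ramify (q * m)) (g \Po 'X^q)) z =
  root (map_poly (fps_ramify m) g) w.
Proof.
move=> q_gt0 zw; rewrite -(root_fps_ramify m g w q_gt0) -zw !rootE.
by rewrite map_comp_poly map_polyXn horner_comp hornerXn.
Qed.

(** * Minimal ramification index of a root *)

Section MinimalRamification.
Variables (K : closedFieldType) (p : nat) (g : {poly fps K}) (N : nat) (z : fps K).
Hypotheses (pK : p \in [pchar K]) (gm : g \is monic).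
Hypotheses (g_irr : irreducible_element g) (N_gt0 : (0 < N)%N).
Hypothesis rz : root (map_poly (fps_ramify N) g) z.
Hypothesis min_N :
  forall N' z', (0 < N')%N -> root (map_poly (fps_ramify N') g) z' -> (N <= N')%N.

(** Otherwise [b] would be a root at the smaller index N / D. *)
Lemma minimal_ramification_not_ramify D b : (1 < D)%N -> (D %| N)%N ->
  z <> fps_ramify D b.
Proof.
move=> D_gt1 /dvdnP[N' NE] zE; have D_gt0 := ltnW D_gt1.
have N'_gt0 : (0 < N')%N by move: N_gt0; rewrite NE muln_gt0 => /andP[].
move: rz; rewrite NE mulnC zE root_fps_ramify // => /(min_N N'_gt0).
by rewrite NE leqNgt ltn_Pmulr.
Qed.

(* If p | N then x d/dx kills K[[x^N]], so applying it to g(z) = 0 gives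
   g'(z) * theta z = 0 and hence theta z = 0. *)
Lemma minimal_ramification_tame m : size g = m.+1 -> ~~ (p %| m)%N -> ~~ (p %| N)%N.
Proof.
case: m => [|m] szg pm; first by rewrite dvdn0 in pm.
apply/negP => pN.
have dg0 : g^`() != 0.
  apply: contraNneq pm => /(congr1 (fun h : {poly fps K} => h`_m)).
  rewrite coef_deriv coef0; have := monicP gm; rewrite /lead_coef szg /= => ->.
  by move/(congr1 (@fps_ct K)); rewrite rmorphMn rmorph1 rmorph0 (dvdn_pcharf pK) => ->.
(* The derivative is nonzero of smaller degree, so it cannot vanish at [z], for which [g] is
   minimal. *)
have dgz : (map_poly (fps_ramify N) g)^`().[z] != 0.
  apply: contraTneq (lt_size_deriv (monic_neq0 gm)) => dgz.
  rewrite -leqNgt; apply: (irreducible_fps_min (fps_ramify_inj N_gt0) gm g_irr rz) => //.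
  by rewrite rootE -deriv_map dgz.
have coef_theta i : fps_theta (map_poly (fps_ramify N) g)`_i = 0.
  by rewrite coef_map; apply: fps_theta_ramify pN.
have := fps_theta_horner z coef_theta; rewrite (rootP rz).
have -> : fps_theta (0 : fps K) = 0 by apply: fpsP => k /=; rewrite mul0rn.
move/esym/eqP; rewrite mulf_eq0 (negPf dgz) => /eqP/(fps_theta_eq0 pK)[b zb].
exact: (minimal_ramification_not_ramify (prime_gt1 (pcharf_prime pK)) pN zb).
Qed.

(** The N conjugates of [z] are distinct roots, so deg g >= N; the orbit polynomial vanishes at [z],
    so minimality gives deg g <= N. *)
Lemma minimal_ramification_size : ~~ (p %| N)%N -> size g = N.+1.
Proof.
rewrite (dvdn_pcharf pK) => NK; have [zeta prim] := closed_prim_root NK.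
have zetaN i : zeta ^+ i ^+ N = 1.
  by rewrite exprAC (prim_expr_order prim) expr1n.
have dil_inj i j : (i < j)%N -> (j < N)%N ->
    fps_dilate (zeta ^+ i) z <> fps_dilate (zeta ^+ j) z.
  move=> lt_ij lt_jN Eij; pose d := gcdn N (j - i).
  have d_gt0 : (0 < d)%N by rewrite gcdn_gt0 N_gt0.
  have /dvdnP[D ND] : (d %| N)%N := dvdn_gcdl _ _.
  have /dvdnP[D' jiD] : (d %| j - i)%N := dvdn_gcdr _ _.
  have copD : coprime D D'.
    by rewrite /coprime -(eqn_pmul2r d_gt0) mul1n muln_gcdl -ND -jiD.
  have D_gt1 : (1 < D)%N.
    rewrite ltnNge; apply/negP => D_le1; have : (N <= j - i)%N.
      rewrite ND (leq_trans (leq_mul D_le1 (leqnn d))) // mul1n.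
      by apply: dvdn_leq; rewrite ?subn_gt0 ?dvdn_gcdr.
    by rewrite leqNgt (leq_ltn_trans (leq_subr _ _)).
  (* Equality of the two conjugates forces N | (j - i) k whenever t^k occurs in [z], hence D | k,
     where D = N / d is coprime to (j - i) / d. *)
  have [b zb] : exists b, z = fps_ramify D b.
    apply: fps_ramifyP => [|k]; first exact: ltnW.
    apply: contraNeq => zk0.
    have := congr1 (fun a : fps K => a k) Eij; rewrite /= => /(mulIf zk0)/eqP.
    rewrite -!exprM (eq_prim_root_expr prim) eq_sym.
    rewrite eqn_mod_dvd ?leq_mul2r ?(ltnW lt_ij) ?orbT //.
    by rewrite -mulnBl jiD {1}ND mulnAC dvdn_pmul2r // Gauss_dvdr.
  by apply: (minimal_ramification_not_ramify D_gt1 _ zb); rewrite ND dvdn_mulr.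
pose rs := [seq fps_dilate (zeta ^+ i) z | i <- iota 0 N].
have root_rs : all (root (map_poly (fps_ramify N) g)) rs.
  apply/allP => _ /mapP[i _ ->].
  suff <- : map_poly (fps_dilate (zeta ^+ i)) (map_poly (fps_ramify N) g) =
      map_poly (fps_ramify N) g by rewrite rootE horner_map (rootP rz) rmorph0.
  by apply/polyP => k; rewrite !coef_map /= fps_dilate_ramify.
have uniq_rs : uniq rs.
  rewrite map_inj_in_uniq ?iota_uniq // => i j; rewrite !mem_iota !add0n /=.
  move=> lt_iN lt_jN Eij; case: (ltngtP i j) => // lt_ij.
    by case: (dil_inj i j).
  by case: (dil_inj j i).
have G0 : map_poly (fps_ramify N) g != 0.
  by rewrite -size_poly_gt0 size_map_fps_ramify // size_poly_gt0 monic_neq0.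
have := max_poly_roots G0 root_rs uniq_rs.
rewrite size_map size_iota size_map_fps_ramify // => lt_N.
have [h [hm szh hz]] := fps_orbit_poly z prim.
apply/eqP; rewrite eqn_leq lt_N andbT -szh.
exact: (irreducible_fps_min (fps_ramify_inj N_gt0) gm g_irr rz hz (monic_neq0 hm)).
Qed.

End MinimalRamification.

(** * Roots in K[[x^(1/m)]] for m prime to p, and the equivalence *)

Lemma irreducible_tame_root (K : closedFieldType) p m (g : {poly fps K}) :
  p \in [pchar K] -> g \is monic -> irreducible_element g -> size g = m.+1 ->
  ~~ (p %| m)%N -> exists z, root (map_poly (fps_ramify m) g) z.
Proof.
move=> pK gm g_irr szg pm.
pose P N := boolp.asbool ((0 < N)%N /\ exists z, root (map_poly (fps_ramify N) g) z).
have exP : exists N, P N.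
  have [N [z [N_gt0 rz]]] := newton_puiseux_tame pK gm szg pm.
  by exists N; apply/boolp.asboolP; split=> //; exists z.
case: (ex_minnP exP) => N /boolp.asboolP[N_gt0 [z rz]] minN.
have min_N N' z' : (0 < N')%N -> root (map_poly (fps_ramify N') g) z' -> (N <= N')%N.
  by move=> N'_gt0 rz'; apply/minN/boolp.asboolP; split=> //; exists z'.
have pN := minimal_ramification_tame pK gm g_irr N_gt0 rz min_N szg pm.
have := minimal_ramification_size pK gm g_irr N_gt0 rz min_N pN.
by rewrite szg => -[->]; exists z.
Qed.

Theorem corollary17p7 (K : closedFieldType) (p : nat) (hp : p \in [pchar K])
    (n : nat) (hn : (1 <= n)%N) (f : {poly fps K})
    (f_monic : f \is monic) (f_deg : size f = n.+1)
    (f_irr : irreducible_element f) :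
  (exists z : fps K, root (map_poly (fps_ramify n) f) z) <->
  (exists g : {poly fps K}, f = g \Po 'X^(p ^ logn p n)).
Proof.
have p_prime := pcharf_prime hp.
have [m p_m] := pfactor_coprime p_prime hn; set q := (p ^ _)%N => nE.
have q_gt0 : (0 < q)%N by rewrite expn_gt0 prime_gt0.
have pm : ~~ (p %| m)%N by rewrite -prime_coprime.
have m_gt0 : (0 < m)%N by case: (m) pm; rewrite ?dvdn0.
have szX : size ('X^q : {poly fps K}) = q.+1 by rewrite size_polyXn.
have size_comp (g : {poly fps K}) : size (g \Po 'X^q) = n.+1 <-> size g = m.+1.
  have predE k l : (0 < l)%N -> (k = l.+1 <-> k.-1 = l) by lia.
  rewrite !predE // size_comp_poly szX /= {1}nE; split=> [/eqP|-> //].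
  by rewrite eqn_pmul2r // => /eqP.
have monic_comp (g : {poly fps K}) : ((g \Po 'X^q) \is monic) = (g \is monic).
  rewrite !monicE lead_coef_comp ?szX ?ltnS //.
  by rewrite lead_coefXn expr1n mulr1.
split=> [[z fz]|[g fE]].
  have [w zw] := fps_expXp hp (logn p n) z.
  have mK : m%:R != 0 :> K by rewrite -(dvdn_pcharf hp).
  have [zeta prim] := closed_prim_root mK.
  have [g [gm szg gw]] := fps_orbit_poly w prim.
  (* g(y^q) is monic of degree n and vanishes at z, as f does. *)
  exists g; apply: (irreducible_fps_minpoly (fps_ramify_inj hn) f_monic f_irr _ _ fz).
  - by rewrite monic_comp.
  - by rewrite f_deg; apply/size_comp.
  - by rewrite {1}nE mulnC (root_ramify_comp_Xn _ _ q_gt0 zw).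
have szg : size g = m.+1 by apply/size_comp; rewrite -fE.
have gm : g \is monic by rewrite -monic_comp -fE.
have g_irr : irreducible_element g.
  by apply: (irreducible_comp_Xn q_gt0); rewrite ?szg // -fE.
have [w gw] := irreducible_tame_root hp gm g_irr szg pm.
have [z zw] := fps_ramify_rootXp (logn p n) w hp.
by exists z; rewrite fE {1}nE mulnC (root_ramify_comp_Xn _ _ q_gt0 zw).
Qed.
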